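(* With the payment scheme $P_i=\alpha_i x_i+B_i(R_i)$, if $B_i(R_i)$ is decreasing (respectively increasing) in $R_i$, then customer $i$ underreports, i.e. $R_i^*<x_i$ (respectively overreports, i.e. $R_i^*>x_i$) her true load reduction $x_i$, where $R_i^*=\arg\max_{R_i}\mathbb{E}_{\mathcal{E}_{-i}}[V_i(B_i(R_i),\alpha_i)]$ is her optimal report.
   Context: A demand response aggregator (DRA) contracts with $N$ customers. Customer $i$ chooses a hidden effort $a_i$ at cost $h(a_i)$; the true load reduction is $x_i=a_i+e_i$, where the $e_i$ are i.i.d. with mean $0$ and variance $\sigma^2$. Knowing her own $x_i$ (but not those of the others), customer $i$ reports a load reduction $R_i$ (ranging over an open interval of admissible reports), with falsification cost $\beta_i(R_i-x_i)^2/2$, $\beta_i>0$. Under a contract $(\alpha_i,B_i)$ she receives $P_i=\alpha_i x_i+B_i(R_i)$, with $\alpha_i$ a constant share and $B_i$ a bonus function, which may also depend on the reports of the other customers (suppressed in the notation). Her utility is $$V_i(B_i(R_i),\alpha_i)=\alpha_i x_i+B_i(R_i)-h(a_i)-\beta_i\frac{(R_i-x_i)^2}{2}.$$ $\mathbb{E}_{\mathcal{E}_{-i}}$ is the expectation over $\{e_j\}_{j\ne i}$, with the other customers' efforts and reporting rules fixed. Standing assumptions: $B_i\ge 0$ on the admissible reports, $B_i$ is twice differentiable and concave in $R_i$, $\sum_i\alpha_i<1$; expectations are finite and $\mathbb{E}_{\mathcal{E}_{-i}}[B_i(R_i)]$ is twice differentiable in $R_i$. ''Decreasing'' and ''increasing''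 are meant strictly. The optimal report is understood to exist. *)

(* Defs.v *)
From HB Require Import structures.
From mathcomp Require Export all_boot all_order all_algebra.
From mathcomp Require Export all_classical all_reals all_analysis.
Export Order.TTheory GRing.Theory Num.Theory numFieldNormedType.Exports.

Set Implicit Arguments.
Unset Strict Implicit.
Unset Printing Implicit Defensive.

Local Open Scope classical_set_scope.
Local Open Scope ring_scope.

Definition mutually_independent (d : measure_display) (T : measurableType d)
    (R : realType) (P : probability T R) (N : nat)
    (e : 'I_N -> {RV P >-> R}) : Prop :=
  forall (S : {set 'I_N}) (A : 'I_N -> set R),
    (forall j, measurable (A j)) ->
    P (\bigcap_(j in [set` S]) (e j @^-1` A j))
      = (\prod_(j in S) P (e j @^-1` A j))%E.

Definition identically_distributed (d : measure_display)
    (T : measurableType d) (R : realType) (P : probability T R) (N : nat)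
    (e : 'I_N -> {RV P >-> R}) : Prop :=
  forall (j k : 'I_N) (A : set R), measurable A ->
    distribution P (e j) A = distribution P (e k) A.

Definition open_interval (R : realType) (J : set R) : Prop :=
  open J /\ is_interval J.

Definition twice_differentiable_on (R : realType) (J : set R) (f : R -> R)
    : Prop :=
  forall r, J r -> derivable f r 1 /\ derivable (derive1 f) r 1.

Definition concave_on (R : realType) (J : set R) (f : R -> R) : Prop :=
  convex_function J (fun r => - f r).

Definition strictly_decreasing_on (R : realType) (J : set R) (f : R -> R)
    : Prop :=
  forall r r', J r -> J r' -> r < r' -> f r' < f r.

Definition strictly_increasing_on (R : realType) (J : set R) (f : R -> R)
    : Prop :=
  forall r r', J r -> J r' -> r < r' -> f r < f r'.

Definition is_argmax (R : realType) (J : set R) (F : R -> \bar R) (r : R)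
    : Prop :=
  J r /\ forall r', J r' -> (F r' <= F r)%E.

(* The joint bonus function [B : 'I_N -> ('I_N -> R) -> R] maps a customer
   and the profile of all reports to that customer's bonus; [own_bonus B s i]
   is customer i's bonus as a function of her own report, the other reports
   being given by [s] (whose i-th entry is irrelevant). *)
Definition own_bonus (R : realType) (N : nat)
    (B : 'I_N -> ('I_N -> R) -> R) (s : 'I_N -> R) (i : 'I_N) (r : R) : R :=
  B i [eta s with i |-> r].

Definition admissible_profile (R : realType) (N : nat) (J : 'I_N -> set R)
    (s : 'I_N -> R) : Prop :=
  forall j, J j (s j).

Definition load (R : realType) (N : nat) (a u : 'I_N -> R) (j : 'I_N) : R :=
  a j + u j.

(* Customer j reports [rho j x] when her true load reduction is [x]. *)
Definition bonus_at (R : realType) (N : nat) (B : 'I_N -> ('I_N -> R) -> R)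
    (a : 'I_N -> R) (rho : 'I_N -> R -> R) (i : 'I_N) (r : R)
    (u : 'I_N -> R) : R :=
  own_bonus B (fun j => rho j (load a u j)) i r.

Definition payment (R : realType) (alpha x b : R) : R := alpha * x + b.

Definition utility (R : realType) (h : R -> R) (alpha beta a x b r : R) : R :=
  payment alpha x b - h a - beta * ((r - x) ^+ 2 / 2).

Definition utility_at (R : realType) (N : nat) (h : R -> R)
    (alpha beta : 'I_N -> R) (B : 'I_N -> ('I_N -> R) -> R)
    (a : 'I_N -> R) (rho : 'I_N -> R -> R) (i : 'I_N) (r : R)
    (u : 'I_N -> R) : R :=
  utility h (alpha i) (beta i) (a i) (load a u i) (bonus_at B a rho i r u) r.

(* Noise profile with customer i's own noise frozen at [eps]. *)
Definition noise_but (d : measure_display) (T : measurableType d)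
    (R : realType) (P : probability T R) (N : nat)
    (e : 'I_N -> {RV P >-> R}) (i : 'I_N) (eps : R) (w : T) : 'I_N -> R :=
  [eta (fun j => e j w) with i |-> eps].

(* Expectation over the noises of the customers other than i, that of i being
   known to equal [eps]; [F] is a function of the whole noise profile. *)
Definition expectation_others (d : measure_display) (T : measurableType d)
    (R : realType) (P : probability T R) (N : nat)
    (e : 'I_N -> {RV P >-> R}) (i : 'I_N) (eps : R)
    (F : ('I_N -> R) -> R) : \bar R :=
  ('E_P[fun w => F (noise_but e i eps w)])%E.

(* Main.v *)
(* Customer i's expected utility is a constant plus E[B_i(r)] minus the
   quadratic falsification cost. Moving the report from Rstar a fraction t of
   the way towards a report r0 with a larger bonus gains at least
   t * (E[B_i(r0)] - E[B_i(Rstar)]) by concavity, whereas the cost increases only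
   by O(t^2) as long as the move does not lead away from x_i at first order.
   Hence no such r0 exists on the side of Rstar facing x_i, nor on either side
   when Rstar = x_i. *)
Require Import Defs.
From mathcomp Require Import ring lra.

Local Open Scope classical_set_scope.
Local Open Scope ring_scope.

(** A nonnegative function with zero integral vanishes almost everywhere. If it is positive
    everywhere, the exceptional null set is the whole space, contradicting total mass 1. *)
Lemma Rintegral_gt0 {d : measure_display} {T : measurableType d}
    {R : realType} {P : probability T R} {f : T -> R} :
  P.-integrable setT (EFin \o f) -> (forall w, 0 < f w) ->
  0 < \int[P]_w f w.
Proof.
move=> fi f0; rewrite lt_neqAle Rintegral_ge0 ?andbT; last by move=> *; exact: ltW.
apply/eqP => int0.
have iE : (\int[P]_w `|(f w)%:E| = 0)%E.
  under eq_integral do rewrite gee0_abs ?lee_fin ?ltW//.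
  by rewrite -[LHS]fineK ?integrable_fin_num// -[fine _]/(Rintegral _ _ _) -int0.
have [N [mN N0 subN]] :=
  (ae_eq_integral_abs P measurableT (measurable_int _ fi)).1 iE.
have NT : N = setT.
  apply/seteqP; split => // w _; apply: subN => /= /(_ I) /eqP.
  by rewrite eqe gt_eqF.
have := probability_setT P; rewrite -NT => /eqP.
by rewrite (N0 : P N = 0%E) eqe eq_sym oner_eq0.
Qed.

Lemma concave_on_conv {R : realType} {J : set R} {f : R -> R} {t x y : R} :
  concave_on J f -> J x -> J y -> 0 <= t -> t <= 1 ->
  t * f x + (1 - t) * f y <= f (t * x + (1 - t) * y).
Proof.
move=> fconc Jx Jy t0 t1.
have := fconc (Itv01 t0 t1) x y (mem_set Jx) (mem_set Jy).
by rewrite !convRE /= !mulrN -opprD lerN2.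
Qed.

(** The cost changes by [b * t * ((r - x) * (r0 - r))], which is nonpositive, plus a term quadratic
    in [t], while [g] gains at least [t * (g r0 - g r)]; a small [t] wins. Concavity of [g] enters
    only along the segment from [r] to [r0]. *)
Lemma quadratic_cost_improvement {R : realType} {g : R -> R}
    {b x r r0 : R} :
  (forall t, 0 <= t -> t <= 1 ->
    t * g r0 + (1 - t) * g r <= g (t * r0 + (1 - t) * r)) ->
  g r < g r0 -> 0 < b -> (r - x) * (r0 - r) <= 0 ->
  exists t, [/\ 0 <= t, t <= 1 &
    g r - b * ((r - x) ^+ 2 / 2) <
    g (t * r0 + (1 - t) * r) - b * ((t * r0 + (1 - t) * r - x) ^+ 2 / 2)].
Proof.
move=> gconc grr0 b0 xr.
have rr0 : r0 - r != 0.
  by apply/eqP => /subr0_eq E; rewrite E ltxx in grr0.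
have l0 : 0 < b * (r0 - r) ^+ 2 by rewrite mulr_gt0// exprn_even_gt0.
(* This makes the quadratic cost term at most half of the gain [t * (g r0 - g r)], so a strict
   surplus remains. *)
pose t := Num.min 1 ((g r0 - g r) / (b * (r0 - r) ^+ 2)).
have t0 : 0 < t by rewrite lt_min ltr01 divr_gt0// subr_gt0.
have t1 : t <= 1 by rewrite ge_min lexx.
have tl : t * (b * (r0 - r) ^+ 2) <= g r0 - g r.
  by rewrite -ler_pdivlMr// ge_min lexx orbT.
exists t; split => //; first exact: ltW.
apply: lt_le_trans (lerB (gconc t (ltW t0) t1) (lexx _)).
rewrite -subr_gt0.
set lhs := (X in 0 < X).
(* With the factor [t] out, the first term is nonnegative by choice of [t], the second is positive,
   and the third, with its sign, is nonnegative. *)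
have -> : lhs = t * ((g r0 - g r - t * (b * (r0 - r) ^+ 2)) +
    (t * (b * (r0 - r) ^+ 2)) / 2 - b * ((r - x) * (r0 - r))).
  by rewrite /lhs; field.
have tl0 : 0 < t * (b * (r0 - r) ^+ 2) by rewrite mulr_gt0.
have bx : b * ((r - x) * (r0 - r)) <= 0 by rewrite pmulr_rle0.
by rewrite mulr_gt0//; lra.
Qed.

Lemma open_exists_lt {R : realType} {J : set R} {r : R} :
  open J -> J r -> exists2 r0, J r0 & r0 < r.
Proof.
move=> oJ Jr; have /nbhs_ballP[e /= e0 ballJ] := open_nbhs_nbhs (conj oJ Jr).
exists (r - e / 2); last by lra.
by apply: ballJ; rewrite /ball /= opprB addrC subrK gtr0_norm; lra.
Qed.

Lemma open_exists_gt {R : realType} {J : set R} {r : R} :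
  open J -> J r -> exists2 r0, J r0 & r < r0.
Proof.
move=> oJ Jr; have /nbhs_ballP[e /= e0 ballJ] := open_nbhs_nbhs (conj oJ Jr).
exists (r + e / 2); last by lra.
by apply: ballJ; rewrite /ball /= opprD addrA subrr add0r normrN gtr0_norm; lra.
Qed.

Theorem corollary1 (R : realType) (d : measure_display)
    (T : measurableType d) (P : probability T R) (N : nat)
    (e : 'I_N -> {RV P >-> R}) (sigma : R)
    (he_indep : mutually_independent e)
    (he_id : identically_distributed e)
    (he_mean : forall j, ('E_P[e j] = 0)%E)
    (he_var : forall j, ('V_P[e j] = (sigma ^+ 2)%:E)%E)
    (h : R -> R) (a : 'I_N -> R)
    (J : 'I_N -> set R) (hJ : forall j, open_interval (J j))
    (alpha beta : 'I_N -> R)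
    (halpha : \sum_(j < N) alpha j < 1)
    (hbeta : forall j, 0 < beta j)
    (B : 'I_N -> ('I_N -> R) -> R)
    (hB_ge0 : forall j s, admissible_profile J s -> 0 <= B j s)
    (hB_diff : forall j s, admissible_profile J s ->
       twice_differentiable_on (J j) (own_bonus B s j))
    (hB_concave : forall j s, admissible_profile J s ->
       concave_on (J j) (own_bonus B s j))
    (i : 'I_N)
    (rho : 'I_N -> R -> R)
    (hrho : forall j, j != i -> forall y, J j (rho j y))
    (w0 : T)
    (hEB_fin : forall r, J i r ->
       P.-integrable setT
         (fun w => (bonus_at B a rho i r (noise_but e i (e i w0) w))%:E))
    (hEB_diff : twice_differentiable_on (J i)
       (fun r => fine (expectation_others e i (e i w0) (bonus_at B a rho i r))))
    (Rstar : R)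
    (hRstar : is_argmax (J i)
       (fun r => expectation_others e i (e i w0)
                   (utility_at h alpha beta B a rho i r))
       Rstar) :
  ((forall s, admissible_profile J s ->
      strictly_decreasing_on (J i) (own_bonus B s i)) ->
   Rstar < a i + e i w0) /\
  ((forall s, admissible_profile J s ->
      strictly_increasing_on (J i) (own_bonus B s i)) ->
   a i + e i w0 < Rstar).
Proof.
have [JRs Rs_max] := hRstar.
set x := a i + e i w0.
pose b r w := bonus_at B a rho i r (noise_but e i (e i w0) w).
pose g r := \int[P]_w b r w.
(* The i-th entry of the profile is overwritten by [own_bonus]; Rstar makes it
   admissible. *)
have bE w : exists2 s, admissible_profile J s & forall r, b r w = own_bonus B s i r.
  exists [eta (fun j => rho j (load a (noise_but e i (e i w0) w) j))
          with i |-> Rstar].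
    by move=> j /=; case: eqVneq => [->//|ji]; exact: hrho.
  move=> r; rewrite /b /bonus_at /own_bonus; congr (B i _); apply/funext => j /=.
  by case: (j == i).
(* With the own noise frozen, the load is the constant [x], so only the bonus is random. *)
have utilE r : J i r ->
    expectation_others e i (e i w0) (utility_at h alpha beta B a rho i r) =
    (alpha i * x - h (a i) + (g r - beta i * ((r - x) ^+ 2 / 2)))%:E.
  move=> Jr; rewrite /expectation_others.
  pose c := alpha i * x - h (a i) - beta i * ((r - x) ^+ 2 / 2).
  have -> : (fun w => utility_at h alpha beta B a rho i r (noise_but e i (e i w0) w))
      = fun w => c + b r w.
    apply/funext => w.
    rewrite /utility_at /utility /payment /load /noise_but /= eqxx -/x /c -/(b r w).
    by rewrite /b /noise_but; ring.
  rewrite unlock.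
  have ci : P.-integrable setT (EFin \o cst c) by exact: finite_measure_integrable_cst.
  have bi : P.-integrable setT (EFin \o b r) := hEB_fin r Jr.
  rewrite -[LHS]fineK; last first.
    exact: (integrable_fin_num measurableT (integrableD measurableT ci bi)).
  rewrite -[fine _]/(Rintegral _ _ _) (RintegralD measurableT ci bi).
  rewrite Rintegral_cst// [fine _](congr1 fine (probability_setT P)) mulr1 -/(g r).
  by congr EFin; rewrite /c; ring.
(* The mixed report is admissible because [J i] is an interval; concavity for each [w] passes to the
   integral. *)
have gconc r0 t : J i r0 -> 0 <= t -> t <= 1 ->
    J i (t * r0 + (1 - t) * Rstar) /\
    t * g r0 + (1 - t) * g Rstar <= g (t * r0 + (1 - t) * Rstar).
  move=> Jr0 t0 t1.
  have Jt : J i (t * r0 + (1 - t) * Rstar).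
    have [rR|/ltW rR] := leP r0 Rstar.
      by apply: ((hJ i).2 r0 Rstar) => //; apply/andP; split; nra.
    by apply: ((hJ i).2 Rstar r0) => //; apply/andP; split; nra.
  split=> //.
  have bi r (Jr : J i r) : P.-integrable setT (EFin \o b r) := hEB_fin r Jr.
  have sbi k r (Jr : J i r) : P.-integrable setT (EFin \o (fun w => k * b r w)).
    exact: (integrableZl measurableT k (bi r Jr)).
  rewrite /g -!RintegralZl//; [|exact: bi..].
  rewrite -RintegralD//; [|exact: sbi..].
  apply: le_Rintegral => //; [|exact: bi|].
    exact: (integrableD measurableT (sbi _ _ Jr0) (sbi _ _ JRs)).
  move=> w _; have [s sJ sE] := bE w; rewrite !sE.
  exact: concave_on_conv (hB_concave i s sJ) _ _ _ _.
(* A bonus gain at every profile gives a strict gain in [g], hence a report better than [Rstar]. *)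
have no_gain r0 : J i r0 -> (Rstar - x) * (r0 - Rstar) <= 0 ->
    (forall s, admissible_profile J s ->
      own_bonus B s i Rstar < own_bonus B s i r0) -> False.
  move=> Jr0 xr0 Blt.
  have bi r (Jr : J i r) : P.-integrable setT (EFin \o b r) := hEB_fin r Jr.
  have glt : g Rstar < g r0.
    rewrite -subr_gt0 /g -RintegralB//; [|exact: bi..].
    apply: Rintegral_gt0.
      exact: (integrableB measurableT (bi _ Jr0) (bi _ JRs)).
    by move=> w; have [s sJ sE] := bE w; rewrite !sE subr_gt0; exact: Blt.
  have [t [t0 t1]] := quadratic_cost_improvement
    (fun t t0 t1 => (gconc r0 t Jr0 t0 t1).2) glt (hbeta i) xr0.
  have [Jt _] := gconc r0 t Jr0 t0 t1.
  have := Rs_max _ Jt; rewrite !utilE// lee_fin lerD2l => le1 lt1.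
  by have := lt_le_trans lt1 le1; rewrite ltxx.
(* The negated claim allows [Rstar = x], where the product in [no_gain] is zero. Openness of [J i]
   supplies [r0] on the side of [Rstar] where the bonus is larger. *)
split=> Bmon; rewrite ltNge; apply/negP => xR.
  have [r0 Jr0 r0R] := open_exists_lt (hJ i).1 JRs.
  apply: (no_gain r0 Jr0); last by move=> s sJ; exact: Bmon.
  by rewrite mulr_ge0_le0// ?subr_ge0// subr_le0 ltW.
have [r0 Jr0 r0R] := open_exists_gt (hJ i).1 JRs.
apply: (no_gain r0 Jr0); last by move=> s sJ; exact: Bmon.
by rewrite mulr_le0_ge0// ?subr_le0// subr_ge0 ltW.
Qed.
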